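(* Let $n\ge 1$ be a fixed integer. For each dimension $d$, let $s_1,\dots,s_n\in\mathbb{R}^d$ be deterministic (signal) vectors, let $\xi_1,\dots,\xi_n\in\mathbb{R}^d$ be random (noise) vectors, all defined on a common probability space, put $x_i=s_i+\xi_i$ $(i=1,\dots,n)$, and let $c_d$ be a real scaling parameter. Assume: (i) for all $1\le i,j\le n$ the limit $\lim_{d\to\infty}d^{-1}s_i^{\top}s_j$ exists, and $\lim_{d\to\infty}d^{-1}\|s_i\|^2>0$ for all $i=1,\dots,n$; (ii) $\lim_{d\to\infty}d^{-1}c_d=\gamma$ exists and $\gamma>0$. Then $\lim_{d\to\infty}K(s_1,\dots,s_n)$ exists. Assume in addition: (iii) there is a constant $\bar\sigma^2\ge 0$ such that, with probability one, $\lim_{d\to\infty}d^{-1}\|\xi_i\|^2=\bar\sigma^2$ for $1\le i\le n$, $\lim_{d\to\infty}d^{-1}\xi_i^{\top}\xi_j=0$ for $1\le i\ne j\le n$, and $\lim_{d\to\infty}d^{-1}s_i^{\top}\xi_j=0$ for $1\le i,j\le n$; (iv) $\lim_{d\to\infty}K(s_1,\dots,s_n)$ is a low rank matrix, i.e. its rank is at most $n-1$. Let $\lambda_1$ be the smallest eigenvalue of $K(x_1,\dots,x_n)$ and define $$\widetilde K(x_1,\dots,x_n)=(1-\lambda_1)^{-1}\bigl(K(x_1,\dots,x_n)-I_n\bigr)+I_n .$$ Then $$\lim_{d\to\infty}\widetilde K(x_1,\dots,x_n)=\lim_{d\to\infty}K(s_1,\dots,s_n)\quad\text{with probability one.}$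$
   Context: $\|\cdot\|$ is the Euclidean norm and $I_n$ the $n\times n$ identity matrix. For $y_1,\dots,y_n\in\mathbb{R}^d$, the Gaussian kernel matrix $K(y_1,\dots,y_n)\in\mathbb{R}^{n\times n}$ has entries $[K(y_1,\dots,y_n)]_{ij}=\exp\bigl(-\|y_i-y_j\|^2/c_d\bigr)$, $i,j=1,\dots,n$ (so its diagonal entries are $1$). The vectors $s_i,\xi_i,x_i$ depend on $d$, which is suppressed in the notation; $n$ is fixed. All expressions are considered for $d$ sufficiently large (in particular $c_d>0$ for large $d$ since $\gamma>0$). Matrix limits are entrywise; ''with probability one'' means that the convergence holds for almost every outcome of the probability space. *)

(* Defs.v *)
From HB Require Import structures.
From mathcomp Require Import all_boot all_order all_algebra.
From mathcomp Require Import all_classical all_reals all_analysis.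

Set Implicit Arguments.
Unset Strict Implicit.
Unset Printing Implicit Defensive.

Import Order.TTheory GRing.Theory Num.Theory.
Import numFieldNormedType.Exports.

Local Open Scope classical_set_scope.
Local Open Scope ring_scope.

Definition dotp {R : realType} {d : nat} (u v : 'cV[R]_d) : R :=
  (u^T *m v) 0 0.

(* The library norm on matrices is the sup norm, so the Euclidean norm is
   introduced separately. *)
Definition enorm {R : realType} {d : nat} (u : 'cV[R]_d) : R :=
  Num.sqrt (dotp u u).

Definition gauss_kernel {R : realType} {n d : nat} (c : R)
    (y : 'I_n -> 'cV[R]_d) : 'M[R]_n :=
  \matrix_(i, j) expR (- (enorm (y i - y j) ^+ 2 / c)).

Definition is_smallest_eigenvalue {R : realType} {n : nat} (A : 'M[R]_n)
    (a : R) : Prop :=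
  eigenvalue A a /\ forall b : R, eigenvalue A b -> a <= b.

(* The default value 0 is returned only when A has no real eigenvalue, which
   does not happen for a symmetric matrix of positive size. *)
Definition smallest_eigenvalue {R : realType} {n : nat} (A : 'M[R]_n) : R :=
  xget 0 [set a | is_smallest_eigenvalue A a].

Definition rescaled_kernel {R : realType} {n : nat} (K : 'M[R]_n) : 'M[R]_n :=
  (1 - smallest_eigenvalue K)^-1 *: (K - 1%:M) + 1%:M.

(* Coordinatewise measurability is Borel measurability into R^d. *)
Definition random_vector {R : realType} {disp : measure_display}
    {T : measurableType disp} {d : nat} (X : T -> 'cV[R]_d) : Prop :=
  forall k : 'I_d, measurable_fun [set: T] (fun w => X w k 0).

(* Main.v *)
(* The noise adds [2 sigma2] to every off-diagonal limiting squared distance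
   and nothing on the diagonal, so [K(x)] tends almost surely to
   [a *: L + (1 - a)%:M] with [L = lim K(s)] and [a = exp(-2 sigma2 / gamma)].
   As a limit of Gaussian kernel matrices [L] is positive semidefinite, and it
   is singular by the rank assumption, so the smallest eigenvalue of this limit
   is exactly [1 - a].  The smallest eigenvalue is continuous on symmetric
   matrices, hence the rescaling undoes the contraction by [a] in the limit. *)
Require Import Defs.
From HB Require Import structures.
From mathcomp Require Import all_boot all_order all_algebra.
From mathcomp Require Import all_classical all_reals all_analysis.
From mathcomp Require Import ring lra.

Set Implicit Arguments.
Unset Strict Implicit.
Unset Printing Implicit Defensive.

Import Order.TTheory GRing.Theory Num.Theory.
Import numFieldNormedType.Exports.

Local Open Scope classical_set_scope.
Local Open Scope ring_scope.

(** * Limits of matrices and of finite sums *)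

Lemma cvg_mx_entrywise (R : realType) (m n : nat) (I : Type)
    (F : set_system I) {FF : Filter F} (f : I -> 'M[R]_(m, n))
    (L : 'M[R]_(m, n)) :
  (forall i j, f x i j @[x --> F] --> L i j) -> f @ F --> L.
Proof.
move=> fL A [Q LQ QA]; rewrite nbhs_filterE.
apply: (@filterS _ F FF (fun x => forall i j, Q i j (f x i j))).
  by move=> x; apply: QA.
have filter_all (k : nat) (D : 'I_k -> set I) :
    (forall i, F (D i)) -> F [set x | forall i, D i x].
  by move=> FD; apply: filter_forall.
apply: (filter_all m) => i; apply: (filter_all n) => j.
exact: (fL i j _ (LQ i j)).
Qed.

Lemma cvg_sum (R : realType) (J : finType) (I : Type) (F : set_system I)
    {FF : Filter F} (f : J -> I -> R) (a : J -> R) :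
  (forall j, f j x @[x --> F] --> a j) ->
  \sum_j f j x @[x --> F] --> \sum_j a j.
Proof.
by move=> fa; apply: cvg_big => [|j _]; [exact: add_continuous|exact: fa].
Qed.

(** * Bilinear forms and positive semidefiniteness *)

Definition bform (R : realType) (n : nat) (A : 'M[R]_n) (u v : 'rV[R]_n) : R :=
  (u *m A *m v^T) 0 0.

Definition psd (R : realType) (n : nat) (A : 'M[R]_n) : Prop :=
  forall v, 0 <= bform A v v.

Section Bform.
Context {R : realType} {n : nat}.
Implicit Types (A B : 'M[R]_n) (u v w : 'rV[R]_n) (a b : R).

Lemma bformE A u v : bform A u v = \sum_i \sum_j u 0 i * A i j * v 0 j.
Proof.
rewrite /bform mxE exchange_big; apply: eq_bigr => j _.
by rewrite !mxE mulr_suml.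
Qed.

Lemma bformDl A u v w : bform A (u + v) w = bform A u w + bform A v w.
Proof. by rewrite /bform !mulmxDl mxE. Qed.

Lemma bformDr A u v w : bform A w (u + v) = bform A w u + bform A w v.
Proof. by rewrite /bform linearD /= mulmxDr mxE. Qed.

Lemma bformZl A a u v : bform A (a *: u) v = a * bform A u v.
Proof. by rewrite /bform -!scalemxAl mxE. Qed.

Lemma bformZr A a u v : bform A u (a *: v) = a * bform A u v.
Proof. by rewrite /bform linearZ /= -scalemxAr mxE. Qed.

Lemma bform_mxD A B u v : bform (A + B) u v = bform A u v + bform B u v.
Proof. by rewrite /bform mulmxDr mulmxDl mxE. Qed.

Lemma bform_mxZ A a u v : bform (a *: A) u v = a * bform A u v.
Proof. by rewrite /bform -scalemxAr -scalemxAl mxE. Qed.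

Lemma bform_mxB A B u v : bform (A - B) u v = bform A u v - bform B u v.
Proof. by rewrite bform_mxD -scaleN1r bform_mxZ mulN1r. Qed.

Lemma bform_scalar a u v : bform a%:M u v = a * bform 1%:M u v.
Proof. by rewrite -[a%:M]scalemx1 bform_mxZ. Qed.

Lemma bform_sym A u v : A^T = A -> bform A u v = bform A v u.
Proof.
move=> sA; rewrite /bform.
have -> : u *m A *m v^T = (v *m A *m u^T)^T.
  by rewrite !trmx_mul trmxK sA mulmxA.
by rewrite mxE.
Qed.

Lemma bform1E u : bform 1%:M u u = \sum_i u 0 i ^+ 2.
Proof.
by rewrite /bform mulmx1 mxE; apply: eq_bigr => i _; rewrite mxE expr2.
Qed.

Lemma bform1_ge0 u : 0 <= bform 1%:M u u.
Proof. by rewrite bform1E sumr_ge0 // => i _; rewrite sqr_ge0. Qed.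

Lemma bform1_gt0 u : u != 0 -> 0 < bform 1%:M u u.
Proof.
move=> u0; rewrite lt_neqAle bform1_ge0 andbT eq_sym bform1E.
apply: contra u0 => /eqP s0; apply/eqP/rowP => i; rewrite [RHS]mxE.
apply/eqP; rewrite -sqrf_eq0; apply/eqP; move: i (erefl true).
by apply: (psumr_eq0P _ s0) => j _; rewrite sqr_ge0.
Qed.

(** The quadratic polynomial [t |-> bform A (u + t *: v) (u + t *: v)] is nonnegative; it is
    evaluated at one well-chosen [t]. *)
Lemma bform_cauchy_schwarz A u v : A^T = A -> psd A ->
  bform A u v ^+ 2 <= bform A u u * bform A v v.
Proof.
move=> sA pA; have q t :
    0 <= bform A u u + 2 * t * bform A u v + t ^+ 2 * bform A v v.
  have := pA (u + t *: v).
  rewrite !(bformDl, bformDr, bformZl, bformZr) (bform_sym v u sA).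
  by congr (_ <= _); ring.
have := pA v; rewrite le_eqVlt => /predU1P[v0|v0]; last first.
  (* This [t] is the minimiser of the polynomial. *)
  have := q (- (bform A u v / bform A v v)).
  rewrite -(pmulr_rge0 _ v0) => h.
  rewrite -subr_ge0; apply: le_trans h _; rewrite le_eqVlt; apply/orP; left.
  by apply/eqP; field; rewrite gt_eqF.
rewrite -v0 mulr0.
have [->|b0] := eqVneq (bform A u v) 0; first by rewrite expr0n.
(* With [bform A v v = 0] the polynomial is affine in [t]; a nonzero slope lets it take the value
   -1, which is absurd. *)
have := q (- (bform A u u + 1) / (2 * bform A u v)).
rewrite -v0 mulr0 addr0.
have -> : bform A u u +
    2 * (- (bform A u u + 1) / (2 * bform A u v)) * bform A u v = -1.
  by field.
by rewrite lerNr oppr0 ler10.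
Qed.

(** Each product [u 0 i * u 0 j] is at most [bform 1%:M u u] in absolute value, since the squares of
    [u 0 i + u 0 j] and [u 0 i - u 0 j] are nonnegative. *)
Lemma bform_bound A u :
  `|bform A u u| <= (\sum_i \sum_j `|A i j|) * bform 1%:M u u.
Proof.
have sq i : u 0 i ^+ 2 <= bform 1%:M u u.
  by rewrite bform1E (bigD1 i) //= lerDl sumr_ge0 // => j _; rewrite sqr_ge0.
rewrite bformE (le_trans (ler_norm_sum _ _ _)) // mulr_suml ler_sum // => i _.
rewrite (le_trans (ler_norm_sum _ _ _)) // mulr_suml ler_sum // => j _.
rewrite mulrAC normrM mulrC ler_wpM2l // ler_norml.
have := sq i; have := sq j.
have := sqr_ge0 (u 0 i - u 0 j); have := sqr_ge0 (u 0 i + u 0 j).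
by rewrite sqrrD sqrrB => h1 h2 h3 h4; apply/andP; split; lra.
Qed.

End Bform.

(** * Existence and continuity of the smallest eigenvalue *)

Section SmallestEigenvalue.
Context {R : realType} {n : nat}.
Implicit Types (A B : 'M[R]_n) (u v : 'rV[R]_n) (a b : R).

Lemma psd_sub_scalar A a :
  psd (A - a%:M) <-> forall v, a * bform 1%:M v v <= bform A v v.
Proof.
by split=> h v; have := h v; rewrite bform_mxB bform_scalar subr_ge0.
Qed.

Lemma eigenvector_bform A a v :
  v *m A = a *: v -> bform A v v = a * bform 1%:M v v.
Proof. by move=> vA; rewrite /bform mulmx1 vA -scalemxAl mxE. Qed.

(** Cauchy-Schwarz for [v] and [v *m invmx A] bounds the square of [bform 1%:M v v] by
    [bform A v v * bform (invmx A) v v], and the last factor is at most [C * bform 1%:M v v]. *)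
Lemma psd_unitmx_coercive A : A^T = A -> psd A -> A \in unitmx ->
  exists2 e, 0 < e & psd (A - e%:M).
Proof.
move=> sA pA uA; pose C := 1 + \sum_i \sum_j `|invmx A i j|.
have C0 : 0 < C.
  by rewrite ltr_pwDl // sumr_ge0 // => i _; rewrite sumr_ge0.
exists C^-1; first by rewrite invr_gt0.
apply/psd_sub_scalar => v; have [->|v0] := eqVneq v 0.
  by rewrite -(scale0r 0) !bformZl !mul0r mulr0.
have vv := bform1_gt0 v0.
have := bform_cauchy_schwarz v (v *m invmx A) sA pA.
have -> : bform A v (v *m invmx A) = bform 1%:M v v.
  by rewrite bform_sym // /bform mulmxKV // mulmx1.
have -> : bform A (v *m invmx A) (v *m invmx A) = bform (invmx A) v v.
  by rewrite /bform mulmxKV // trmx_mul trmx_inv sA mulmxA.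
have le_inv : bform (invmx A) v v <= C * bform 1%:M v v.
  rewrite (le_trans (ler_norm _)) // (le_trans (bform_bound _ _)) //.
  by rewrite ler_pM2r // /C lerDr.
move=> /le_trans /(_ (ler_wpM2l (pA v) le_inv)).
by rewrite expr2 mulrA ler_pM2r // ler_pdivrMl // mulrC.
Qed.

(* The minimum of the Rayleigh quotient is obtained as the largest [a] with
   [A - a] positive semidefinite; were [A - a] invertible it would be
   coercive, and [a] could be increased. *)
Lemma symmetric_min_eigenvalue A : (0 < n)%N -> A^T = A ->
  exists2 a, eigenvalue A a & psd (A - a%:M).
Proof.
move=> n0 sA; pose S := [set a | psd (A - a%:M)].
(* A nonzero test vector, as [0 < n]; its Rayleigh quotient bounds [S] from above. *)
pose u : 'rV[R]_n := const_mx 1.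
have u0 : u != 0.
  apply/eqP => /rowP /(_ (Ordinal n0)); rewrite !mxE => /eqP.
  by rewrite oner_eq0.
have supS : has_sup S.
  split.
    exists (- \sum_i \sum_j `|A i j|); apply/psd_sub_scalar => v.
    by have := bform_bound A v; rewrite ler_norml mulNr => /andP[].
  exists (bform A u u / bform 1%:M u u) => a /psd_sub_scalar /(_ u).
  by rewrite ler_pdivlMr // bform1_gt0.
have pS : psd (A - (sup S)%:M).
  apply/psd_sub_scalar => v; have [->|v0] := eqVneq v 0.
    by rewrite -(scale0r 0) !bformZl !mul0r mulr0.
  have vv := bform1_gt0 v0.
  rewrite -ler_pdivlMr //; apply: ge_sup; first by case: supS.
  by move=> b /psd_sub_scalar /(_ v); rewrite ler_pdivlMr.
exists (sup S) => //.
have sB : (A - (sup S)%:M)^T = A - (sup S)%:M.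
  by rewrite linearB /= sA tr_scalar_mx.
rewrite /eigenvalue /eigenspace kermx_eq0 row_free_unit; apply/negP => uB.
have [e e0] := psd_unitmx_coercive sB pS uB.
rewrite -addrA -opprD -raddfD /= => Se.
by have := ub_le_sup (proj2 supS) Se; rewrite gerDl leNgt e0.
Qed.

(** Every eigenvalue is the Rayleigh quotient of its eigenvector, hence at least [a]. This criterion
    is how [xget] gets evaluated. *)
Lemma smallest_eigenvalue_unique A a : eigenvalue A a -> psd (A - a%:M) ->
  smallest_eigenvalue A = a.
Proof.
move=> ea /psd_sub_scalar pa.
have sa : is_smallest_eigenvalue A a.
  split=> // b /eigenvalueP[v vA v0].
  by have := pa v; rewrite (eigenvector_bform vA) ler_pM2r // bform1_gt0.
apply: xget_unique => // b [eb minb].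
by apply/eqP; rewrite eq_le minb // (proj2 sa).
Qed.

Lemma smallest_eigenvalueP A : (0 < n)%N -> A^T = A ->
  eigenvalue A (smallest_eigenvalue A) /\ psd (A - (smallest_eigenvalue A)%:M).
Proof.
move=> n0 sA; have [a ea pa] := symmetric_min_eigenvalue n0 sA.
by rewrite (smallest_eigenvalue_unique ea pa).
Qed.

(** The form of [A] is tested on an eigenvector of [B] for its smallest eigenvalue. Exchanging [A]
    and [B] gives a Lipschitz bound, hence continuity. *)
Lemma smallest_eigenvalue_le A B : (0 < n)%N -> A^T = A -> B^T = B ->
  smallest_eigenvalue A - smallest_eigenvalue B
    <= \sum_i \sum_j `|A i j - B i j|.
Proof.
move=> n0 sA sB.
have [_ /psd_sub_scalar pA] := smallest_eigenvalueP n0 sA.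
have [/eigenvalueP[v vB v0] _] := smallest_eigenvalueP n0 sB.
have := le_trans (pA v) (ler_norm _); have := bform_bound (A - B) v.
under eq_bigr do under eq_bigr do rewrite !mxE.
move=> hAB _; rewrite -(ler_pM2r (bform1_gt0 v0)).
apply: le_trans hAB; apply: le_trans (ler_norm _).
by rewrite mulrBl bform_mxB (eigenvector_bform vB) lerB.
Qed.

Lemma cvg_smallest_eigenvalue (f : nat -> 'M[R]_n) A : (0 < n)%N ->
  (forall k, (f k)^T = f k) -> A^T = A ->
  (forall i j, f k i j @[k --> \oo] --> A i j) ->
  smallest_eigenvalue (f k) @[k --> \oo] --> smallest_eigenvalue A.
Proof.
move=> n0 sf sA fA.
have d0 : \sum_i \sum_j `|f k i j - A i j| @[k --> \oo] --> (0 : R).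
  have z : \sum_(i < n) \sum_(j < n) 0 = 0 :> R.
    by rewrite big1 // => i _; rewrite big1.
  rewrite -[X in _ --> X]z.
  apply: cvg_sum => i; apply: cvg_sum => j.
  rewrite -(normr0 R) -(subrr (A i j)); apply: cvg_norm.
  by apply: cvgB; [exact: fA|exact: cvg_cst].
apply/cvgrPdist_le => e e0; move/cvgr0Pnorm_le: d0 => /(_ e e0).
apply: filterS => k; rewrite ger0_norm; last first.
  by rewrite sumr_ge0 // => i _; rewrite sumr_ge0.
move=> le_e; rewrite ler_norml; apply/andP; split.
  rewrite lerNl opprB; apply: le_trans le_e; exact: smallest_eigenvalue_le.
apply: le_trans le_e; apply: le_trans (smallest_eigenvalue_le _ _ _) _ => //.
by apply: ler_sum => i _; apply: ler_sum => j _; rewrite distrC.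
Qed.

End SmallestEigenvalue.

(** * Closure properties of positive semidefinite matrices *)

Section PositiveSemidefinite.
Context {R : realType} {n : nat}.
Implicit Types (A B : 'M[R]_n) (u v w : 'rV[R]_n) (a b : R).

Lemma psd_sum (r : seq nat) (f : nat -> 'M[R]_n) :
  (forall k, psd (f k)) -> psd (\sum_(k <- r) f k).
Proof.
move=> pf; apply: big_ind => // [v|A B pA pB v].
  by rewrite /bform mulmx0 mul0mx mxE.
by rewrite bform_mxD addr_ge0 // ?pA ?pB.
Qed.

Lemma psdZ A a : 0 <= a -> psd A -> psd (a *: A).
Proof. by move=> a0 pA v; rewrite bform_mxZ mulr_ge0. Qed.

(** For fixed [v] the condition is closed in the entries. Semidefiniteness is asked only eventually
    because [c d] may fail to be positive for small [d]. *)
Lemma psd_cvg (f : nat -> 'M[R]_n) A :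
  (forall i j, f k i j @[k --> \oo] --> A i j) ->
  (\forall k \near \oo, psd (f k)) -> psd A.
Proof.
move=> fA pf v; apply: (@cvgr_to_ge _ \oo _ R (fun k => bform (f k) v v)).
  rewrite bformE; under eq_fun do rewrite bformE.
  apply: cvg_sum => i; apply: cvg_sum => j.
  apply: cvgM; last exact: cvg_cst.
  by apply: cvgM; [exact: cvg_cst|exact: fA].
by apply: filterS pf => k /(_ v).
Qed.

Lemma psd_congr_diag A (g : 'I_n -> R) : psd A ->
  psd (\matrix_(i, j) (g i * A i j * g j)).
Proof.
move=> pA v; have := pA (\row_i (v 0 i * g i)); rewrite !bformE.
congr (_ <= _); apply: eq_bigr => i _; apply: eq_bigr => j _.
by rewrite !mxE; ring.
Qed.

(** A case of the Schur product theorem: the Gram matrix is a sum over coordinates [l] of rank-one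
    matrices, and a Hadamard product with one of these is a diagonal congruence. *)
Lemma psd_hadamard_gram A d (y : 'I_n -> 'cV[R]_d) : psd A ->
  psd (\matrix_(i, j) (A i j * dotp (y i) (y j))).
Proof.
move=> pA v.
have -> : bform (\matrix_(i, j) (A i j * dotp (y i) (y j))) v v =
    \sum_l bform A (\row_i (v 0 i * y i l 0)) (\row_i (v 0 i * y i l 0)).
  under [RHS]eq_bigr do rewrite bformE.
  rewrite bformE [RHS]exchange_big; apply: eq_bigr => i _.
  rewrite [RHS]exchange_big; apply: eq_bigr => j _.
  rewrite !mxE /dotp mxE mulr_sumr mulr_sumr mulr_suml.
  by apply: eq_bigr => l _; rewrite !mxE; ring.
by rewrite sumr_ge0.
Qed.

Lemma psd_gram_exp d (y : 'I_n -> 'cV[R]_d) k :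
  psd (\matrix_(i, j) (dotp (y i) (y j) ^+ k)).
Proof.
elim: k => [|k IHk].
  (* The zeroth Hadamard power is the all-ones matrix, whose quadratic form is a perfect square. *)
  move=> v; suff -> : bform (\matrix_(i, j) (dotp (y i) (y j) ^+ 0)) v v =
      (\sum_i v 0 i) ^+ 2 by rewrite sqr_ge0.
  rewrite bformE expr2 mulr_suml; apply: eq_bigr => i _.
  by rewrite mulr_sumr; apply: eq_bigr => j _; rewrite mxE expr0 mulr1.
have := psd_hadamard_gram y IHk; congr psd.
by apply/matrixP => i j; rewrite !mxE exprSr.
Qed.

(** Partial sums of the exponential series are combinations of Hadamard powers, with coefficients
    nonnegative because [0 <= b]. *)
Lemma psd_expR_gram d (y : 'I_n -> 'cV[R]_d) b : 0 <= b ->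
  psd (\matrix_(i, j) expR (b * dotp (y i) (y j))).
Proof.
move=> b0.
apply: (@psd_cvg (fun N => \sum_(0 <= k < N) (b ^+ k / k`!%:R) *:
  \matrix_(i, j) (dotp (y i) (y j) ^+ k))).
  move=> i j; rewrite mxE.
  set f := (X in X @ _ --> _).
  have -> : f = series (exp_coeff (b * dotp (y i) (y j))); last first.
    exact: is_cvg_series_exp_coeff.
  apply/funext => N; rewrite /f summxE /series /=; apply: eq_bigr => k _.
  by rewrite /exp_coeff /= !mxE exprMn; ring.
apply: nearW => N; apply: psd_sum => k; apply: psdZ; last exact: psd_gram_exp.
by rewrite divr_ge0 // exprn_ge0.
Qed.

End PositiveSemidefinite.

(** * Gaussian kernel matrices and their limits *)

Section GaussianKernel.
Context {R : realType}.
Implicit Types (n d : nat).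

Lemma dotpC d (u v : 'cV[R]_d) : dotp u v = dotp v u.
Proof. by rewrite /dotp !mxE; apply: eq_bigr => l _; rewrite !mxE mulrC. Qed.

Lemma dotpDl d (u v w : 'cV[R]_d) : dotp (u + v) w = dotp u w + dotp v w.
Proof. by rewrite /dotp linearD /= mulmxDl mxE. Qed.

Lemma dotpNl d (u v : 'cV[R]_d) : dotp (- u) v = - dotp u v.
Proof. by rewrite /dotp linearN /= mulNmx mxE. Qed.

Lemma enorm_sqr d (u : 'cV[R]_d) : enorm u ^+ 2 = dotp u u.
Proof.
rewrite sqr_sqrtr // /dotp mxE sumr_ge0 // => l _.
by rewrite mxE -expr2 sqr_ge0.
Qed.

Lemma enorm_sub_sqr d (u v : 'cV[R]_d) :
  enorm (u - v) ^+ 2 = dotp u u - 2 * dotp u v + dotp v v.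
Proof.
rewrite enorm_sqr !dotpDl !dotpNl ![dotp _ (u - v)]dotpC !dotpDl !dotpNl.
by rewrite (dotpC v u); ring.
Qed.

Lemma gauss_kernel_sym n d c (y : 'I_n -> 'cV[R]_d) :
  (gauss_kernel c y)^T = gauss_kernel c y.
Proof.
apply/matrixP => i j; rewrite !mxE !enorm_sub_sqr (dotpC (y j)).
by congr (expR (- (_ / c))); ring.
Qed.

(* [exp(-|u-v|^2/c) = exp(-|u|^2/c) exp(2 u.v/c) exp(-|v|^2/c)], and the middle
   factor is a limit of nonnegative combinations of Hadamard powers of a Gram
   matrix. *)
Lemma psd_gauss_kernel n d c (y : 'I_n -> 'cV[R]_d) : 0 < c ->
  psd (gauss_kernel c y).
Proof.
move=> c0; have b0 : 0 <= 2 / c by rewrite divr_ge0 // ltW.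
have := psd_congr_diag (fun i => expR (- (dotp (y i) (y i) / c)))
  (psd_expR_gram y b0).
congr psd; apply/matrixP => i j; rewrite !mxE -!expRD enorm_sub_sqr.
by congr expR; ring.
Qed.

Lemma cvg_gauss_kernel n (c : nat -> R) (gamma : R)
    (y : forall d, 'I_n -> 'cV[R]_d) (G : 'I_n -> 'I_n -> R) :
  0 < gamma ->
  (fun d : nat => d%:R^-1 * c d) @ \oo --> gamma ->
  (forall i j,
     (fun d : nat => d%:R^-1 * dotp (y d i) (y d j)) @ \oo --> G i j) ->
  forall i j, gauss_kernel (c d) (y d) i j @[d --> \oo] -->
    expR (- ((G i i - 2 * G i j + G j j) / gamma)).
Proof.
move=> g0 cg yG i j; under eq_fun do rewrite mxE.
apply: continuous_cvg; first exact: continuous_expR.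
apply: cvgN.
have : (d%:R^-1 * dotp (y d i) (y d i) - 2 * (d%:R^-1 * dotp (y d i) (y d j))
    + d%:R^-1 * dotp (y d j) (y d j)) / (d%:R^-1 * c d) @[d --> \oo] -->
    (G i i - 2 * G i j + G j j) / gamma.
  apply: cvgM; last by apply: cvgV => //; rewrite gt_eqF.
  apply: cvgD => //; apply: cvgB => //.
  by apply: cvgM; [exact: cvg_cst|exact: yG].
(* The factors [d%:R^-1] cancel only for [d >= 1], since the inverse of 0 is 0. *)
apply: cvg_trans; apply: near_eq_cvg; exists 1%N => // d /= d0.
rewrite enorm_sub_sqr invfM invrK.
have : (d%:R : R) != 0 by rewrite pnatr_eq0 -lt0n.
(* Generalizing the inverse spares [field] the condition [c d != 0], which may fail for small
   [d]. *)
by move: ((c d)^-1) => e d1; field.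
Qed.

End GaussianKernel.

(** * Undoing the contraction towards the identity *)

Section ScalarShift.
Context {R : realType} {n : nat}.
Implicit Types (A : 'M[R]_n) (a : R).

(** A kernel vector of [A] is an eigenvector for [1 - a], and subtracting [(1 - a)%:M] leaves the
    semidefinite [a *: A]. *)
Lemma smallest_eigenvalue_convex_singular A a : (0 < n)%N -> 0 <= a -> psd A ->
  (\rank A <= n - 1)%N ->
  smallest_eigenvalue (a *: A + (1 - a)%:M) = 1 - a.
Proof.
move=> n0 a0 pA rkA; apply: smallest_eigenvalue_unique; last first.
  by rewrite addrK; apply: psdZ.
have : eigenvalue A 0.
  rewrite /eigenvalue /eigenspace raddf0 subr0 kermx_eq0 /row_free ltn_eqF //.
  by rewrite (leq_ltn_trans rkA) // subn1 ltn_predL.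
move=> /eigenvalueP[v vA v0]; apply/eigenvalueP; exists v => //.
by rewrite mulmxDr -scalemxAr vA scale0r scaler0 add0r mul_mx_scalar.
Qed.

Lemma rescaled_kernel_convex A a :
  smallest_eigenvalue (a *: A + (1 - a)%:M) = 1 - a ->
  a != 0 -> rescaled_kernel (a *: A + (1 - a)%:M) = A.
Proof.
move=> eA a0; rewrite /rescaled_kernel eA subKr.
have -> : a *: A + (1 - a)%:M - 1%:M = a *: (A - 1%:M).
  by apply/matrixP => i j; rewrite !mxE mulrnBl mulrBr mulr_natr; ring.
by rewrite scalerK // subrK.
Qed.

(** The assumption [smallest_eigenvalue A != 1] makes inversion continuous at the limiting
    prefactor. *)
Lemma cvg_rescaled_kernel (f : nat -> 'M[R]_n) A : (0 < n)%N ->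
  (forall k, (f k)^T = f k) -> A^T = A -> smallest_eigenvalue A != 1 ->
  (forall i j, f k i j @[k --> \oo] --> A i j) ->
  rescaled_kernel (f k) @[k --> \oo] --> rescaled_kernel A.
Proof.
move=> n0 sf sA A1 fA; apply: cvg_mx_entrywise => i j; rewrite !mxE.
under eq_fun do rewrite !mxE.
apply: cvgD; last exact: cvg_cst.
apply: cvgM; last by apply: cvgB; [exact: fA|exact: cvg_cst].
apply: cvgV; first by rewrite subr_eq0 eq_sym.
by apply: cvgB; [exact: cvg_cst|exact: cvg_smallest_eigenvalue].
Qed.

End ScalarShift.

(** The signal-noise cross terms vanish in the limit. In the application [m] is [sigma2] on the
    diagonal and 0 off it. *)
Lemma cvg_dotp_noisy (R : realType) (s1 s2 x1 x2 : forall d, 'cV[R]_d)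
    (l m : R) :
  (fun d : nat => d%:R^-1 * dotp (s1 d) (s2 d)) @ \oo --> l ->
  (fun d : nat => d%:R^-1 * dotp (s1 d) (x2 d)) @ \oo --> (0 : R) ->
  (fun d : nat => d%:R^-1 * dotp (s2 d) (x1 d)) @ \oo --> (0 : R) ->
  (fun d : nat => d%:R^-1 * dotp (x1 d) (x2 d)) @ \oo --> m ->
  (fun d : nat => d%:R^-1 * dotp (s1 d + x1 d) (s2 d + x2 d)) @ \oo --> l + m.
Proof.
move=> ss sx xs xx.
have E (d : nat) : d%:R^-1 * dotp (s1 d + x1 d) (s2 d + x2 d) =
    (d%:R^-1 * dotp (s1 d) (s2 d) + d%:R^-1 * dotp (s1 d) (x2 d)) +
    (d%:R^-1 * dotp (s2 d) (x1 d) + d%:R^-1 * dotp (x1 d) (x2 d)).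
  rewrite dotpDl !(dotpC _ (s2 d + x2 d)) !dotpDl.
  rewrite (dotpC (s2 d) (s1 d)) (dotpC (x2 d) (s1 d)) (dotpC (x2 d) (x1 d)).
  by ring.
under eq_fun do rewrite E.
have -> : l + m = (l + 0) + (0 + m) by rewrite addr0 add0r.
by do 2?apply: cvgD.
Qed.


Theorem theorem2 (R : realType) (n : nat) (n_ge1 : (1 <= n)%N)
    (disp : measure_display) (T : measurableType disp) (P : probability T R)
    (s : forall d : nat, 'I_n -> 'cV[R]_d)
    (xi : forall d : nat, 'I_n -> T -> 'cV[R]_d)
    (xi_rv : forall (d : nat) (i : 'I_n), random_vector (xi d i))
    (c : nat -> R) (gamma : R)
    (s_lim : forall i j : 'I_n,
       cvg ((fun d : nat => d%:R^-1 * dotp (s d i) (s d j)) @ \oo))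
    (s_pos : forall i : 'I_n,
       0 < lim ((fun d : nat => d%:R^-1 * enorm (s d i) ^+ 2) @ \oo))
    (c_lim : (fun d : nat => d%:R^-1 * c d) @ \oo --> gamma)
    (gamma_gt0 : 0 < gamma) :
  let Ks := fun d : nat => gauss_kernel (c d) (s d) in
  let Kx := fun (d : nat) (w : T) =>
    gauss_kernel (c d) (fun i : 'I_n => s d i + xi d i w) in
  cvg (Ks @ \oo) /\
  ((exists2 sigma2 : R, 0 <= sigma2 &
      {ae P, forall w : T,
        [/\ forall i : 'I_n,
              (fun d : nat => d%:R^-1 * enorm (xi d i w) ^+ 2) @ \oo --> sigma2,
            forall i j : 'I_n, i != j ->
              (fun d : nat => d%:R^-1 * dotp (xi d i w) (xi d j w)) @ \oo
                --> (0 : R)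
          & forall i j : 'I_n,
              (fun d : nat => d%:R^-1 * dotp (s d i) (xi d j w)) @ \oo
                --> (0 : R)]}) ->
   (\rank (lim (Ks @ \oo)) <= n - 1)%N ->
   {ae P, forall w : T,
     (fun d : nat => rescaled_kernel (Kx d w)) @ \oo --> lim (Ks @ \oo)}).

Proof.
move=> Ks Kx.
pose G i j := lim ((fun d : nat => d%:R^-1 * dotp (s d i) (s d j)) @ \oo).
pose L : 'M[R]_n :=
  \matrix_(i, j) expR (- ((G i i - 2 * G i j + G j j) / gamma)).
have KsE i j : Ks d i j @[d --> \oo] --> L i j.
  rewrite mxE; apply: cvg_gauss_kernel => //; exact: s_lim.
have KsL : Ks @ \oo --> L by apply: cvg_mx_entrywise.
split; first by apply/cvg_ex; exists L.
rewrite (cvg_lim _ KsL); last exact: norm_hausdorff.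
move=> [sigma2 _ xi_lim] rkL.
have L_psd : psd L.
  apply: psd_cvg KsE _.
  have : \forall d \near \oo, 0 < d%:R^-1 * c d by apply: cvgr_gt c_lim _ _.
  (* At [d = 0] the scaled parameter is 0, not positive; otherwise [c d] inherits its sign. *)
  apply: filterS => d; have [->|d0] := eqVneq d 0%N.
    by rewrite invr0 mul0r ltxx.
  rewrite pmulr_rgt0 ?invr_gt0 ?ltr0n ?lt0n // => cd0.
  exact: psd_gauss_kernel.
pose a := expR (- (2 * sigma2 / gamma)).
have a0 : 0 < a by exact: expR_gt0.
pose M := a *: L + (1 - a)%:M.
have seM : smallest_eigenvalue M = 1 - a.
  by apply: smallest_eigenvalue_convex_singular => //; exact: ltW.
have sL : L^T = L.
  apply/matrixP => i j; rewrite !mxE.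
  have -> : G i j = G j i by rewrite /G; under eq_fun do rewrite dotpC.
  by move: (G i i) (G j i) (G j j) => x y z; congr expR; ring.
have sM : M^T = M by rewrite linearD linearZ /= sL tr_scalar_mx.
(* With the target written this way, continuity of the rescaling reduces the claim to convergence of
   the noisy kernels to [M], for each fixed good outcome. *)
have <- : rescaled_kernel M = L.
  by apply: rescaled_kernel_convex; rewrite ?gt_eqF.
apply: filterS xi_lim => w [xi_sqr xi_xi s_xi].
apply: cvg_rescaled_kernel => //.
- by move=> d; exact: gauss_kernel_sym.
- by rewrite seM -subr_eq0 addrAC subrr add0r oppr_eq0 gt_eqF.
move=> i j.
(* The limiting scaled Gram matrix of the noisy vectors. *)
pose H i j := G i j + (if i == j then sigma2 else 0).
have -> : M i j = expR (- ((H i i - 2 * H i j + H j j) / gamma)).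
  rewrite /M /H !mxE !eqxx; have [<-|ij] := eqVneq i j.
    move: (G i i) => x; have E y : y - 2 * y + y = 0 :> R by ring.
    by rewrite !E mul0r oppr0 expR0 mulr1n; ring.
  rewrite mulr0n addr0 /a -expRD; move: (G i i) (G i j) (G j j) => x y z.
  by congr expR; ring.
apply: cvg_gauss_kernel => // {}i {}j; apply: cvg_dotp_noisy.
- exact: s_lim.
- exact: s_xi.
- exact: s_xi.
have [<-|ij] := eqVneq i j; last exact: xi_xi.
by under eq_fun do rewrite -enorm_sqr; exact: xi_sqr.
Qed.
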